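(* Let $\mathcal F$ be a $1$-dense union-closed family over $[n]$, let $\mathcal G$ be the family of all inclusion-wise minimal members of $\mathcal F$, and let $\mathcal H\subseteq\mathcal F$ be a union-closed family with $\overline{\mathcal H}\supseteq\mathcal F$. Then $\overline{\mathcal H}\supseteq\overline{\langle\mathcal G\rangle_{\mathcal F}}$.
   Context: A family of subsets of $[n]$ is union-closed over $[n]$ if it contains $[n]$ and is closed under pairwise unions; the empty set is never a member of any family, and $2^{[n]}$ denotes all nonempty subsets of $[n]$. The closure of a union-closed $\mathcal H$ is $\overline{\mathcal H}=\{A\in 2^{[n]}:\ \mathcal H\cup\{A\}\text{ is union-closed}\}$; $\mathcal F$ is $1$-dense if $\mathcal F\ne 2^{[n]}$ and $\overline{\mathcal F}=2^{[n]}$. Relative subsets: for $A,B\in\mathcal F$, $A\subseteq_{\mathcal F}B$ means that $A=B$, or $B=[n]$, or there exists $C\in\mathcal F$ with $C\neq B$ and $A\cup C=B$. For $\mathcal K\subseteq\mathcal F$, $\langle\mathcal K\rangle_{\mathcal F}=\{B\in\mathcal F:\ \exists A\in\mathcal K,\ A\subseteq_{\mathcal F}B\}$ (this is union-closed when $\mathcal F$ is $1$-dense and $\mathcal K\neq\emptyset$), and $\overline{\langle\mathcal G\rangle_{\mathcal F}}$ is its closure. *)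

(* Defs.v *)
From mathcomp Require Import all_boot.

Set Implicit Arguments.
Unset Strict Implicit.
Unset Printing Implicit Defensive.

Section Families.

Variable n : nat.
Implicit Types (F H K : {set {set 'I_n}}) (A B : {set 'I_n}).

Definition nonempty_subsets : {set {set 'I_n}} := [set A | A != set0].

Definition union_closed F : bool :=
  [&& F \subset nonempty_subsets,
      [set: 'I_n] \in F
    & [forall A in F, forall B in F, A :|: B \in F]].

Definition uc_closure H : {set {set 'I_n}} :=
  [set A in nonempty_subsets | union_closed (A |: H)].

Definition one_dense F : bool :=
  (F != nonempty_subsets) && (uc_closure F == nonempty_subsets).

(* A and B are intended to be members of F; membership is not part of the
   relation itself. *)
Definition rel_subset F A B : bool :=
  [|| A == B,
      B == [set: 'I_n]
    | [exists C in F, (C != B) && (A :|: C == B)]].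

Definition rel_upset F K : {set {set 'I_n}} :=
  [set B in F | [exists A in K, rel_subset F A B]].

Definition minimal_members F : {set {set 'I_n}} :=
  [set A | minset (mem F) A].

End Families.

(* Main.v *)
Require Import Defs.
From mathcomp Require Import all_boot.

(** A 1-dense union-closed family [F] is an up-set.  Let [X] be in the closure
    of the relative up-set [K] of the minimal members, let [C \in H] and
    [S = X :|: C].  If some [B \in F], [B != S], has [B :|: C = S], then
    [S \in H] because [F] lies in the closure of [H].  Otherwise every member
    of [F] inside [S] contains [C], so [C] is minimal and lies in [K]; hence
    [S] is [X] or lies in [K].  In the latter case the relative inclusion
    placing [S] in [K] can only start at [C], so either [S] is [C] or the full
    set, both in [H], or it provides such a [B] after all. *)

Lemma mem_uc_closureU {n : nat} {H : {set {set 'I_n}}} {A B : {set 'I_n}} :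
  A \in uc_closure H -> B \in H -> A :|: B \in A |: H.
Proof.
rewrite inE => /andP[_ /and3P[_ _ /forall_inP HU]] HB.
by move/forall_inP: (HU _ (setU11 A H)); apply; rewrite setU1r.
Qed.

Lemma mem_uc_closure {n : nat} {H : {set {set 'I_n}}} {A : {set 'I_n}} :
  union_closed H -> A != set0 -> {in H, forall B, A :|: B \in A |: H} ->
  A \in uc_closure H.
Proof.
case/and3P=> /subsetP H0 HT /forall_inP HU A0 cl.
rewrite !inE A0 /=; apply/and3P; split.
- by apply/subsetP=> B /setU1P[->|/H0 //]; rewrite inE.
- by rewrite setU1r.
- apply/forall_inP=> B /setU1P[->|HB]; apply/forall_inP=> D /setU1P[->|HD].
  + by rewrite setUid setU11.
  + exact: cl.
  + by rewrite setUC cl.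
  + by rewrite setU1r //; move/forall_inP: (HU _ HB); apply.
Qed.

(** For [d] in [D] and proper inclusion, [T :\ d] is nonempty, so density puts it in the closure of
    [F]. Its union with [D] is [T], which differs from [T :\ d] and hence is in [F]. *)
Lemma one_dense_upset {n : nat} {F : {set {set 'I_n}}} {D T : {set 'I_n}} :
  union_closed F -> one_dense F -> D \in F -> D \subset T -> T \in F.
Proof.
move=> ucF /andP[_ /eqP clF] FD sDT.
have [<- //|neqDT] := eqVneq D T.
have ltDT : D \proper T by rewrite properEneq neqDT.
have /set0Pn[d Dd] : D != set0.
  by case/and3P: ucF => /subsetP/(_ _ FD); rewrite inE.
case/properP: ltDT => _ [t Tt DNt].
have : T :\ d \in uc_closure F.
  rewrite clF inE; apply/set0Pn; exists t.
  by rewrite !inE Tt andbT; apply: contraNneq DNt => ->.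
move/mem_uc_closureU/(_ FD).
have -> : (T :\ d) :|: D = T.
  apply/setP=> x; rewrite !inE; case: eqVneq => [->|_] /=.
    by rewrite Dd (subsetP sDT).
  by apply/orb_idr/(subsetP sDT).
by case/setU1P=> // eqT; move: (subsetP sDT d Dd); rewrite eqT setD11.
Qed.

Theorem theorem4 (n : nat) (F H : {set {set 'I_n}})
  (F_union_closed : union_closed F)
  (F_one_dense : one_dense F)
  (H_sub_F : H \subset F)
  (H_union_closed : union_closed H)
  (F_sub_clH : F \subset uc_closure H) :
  uc_closure (rel_upset F (minimal_members F)) \subset uc_closure H.
Proof.
have HT : [set: 'I_n] \in H by case/and3P: H_union_closed.
apply/subsetP=> X KX; apply: mem_uc_closure => //.
  by move: KX; rewrite !inE => /andP[].
move=> C HC; have FC := subsetP H_sub_F C HC.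
set S := X :|: C; have sCS : C \subset S := subsetUr X C.
have HS B : B \in F -> B != S -> B :|: C = S -> S \in H.
  move=> FB neqBS eqS; have := mem_uc_closureU (subsetP F_sub_clH B FB) HC.
  by rewrite eqS => /setU1P[eqSB|//]; rewrite eqSB eqxx in neqBS.
have [[B /and3P[FB neqBS /eqP eqS]]|noB] :=
    altP (@existsP _ (fun B => [&& B \in F, B != S & B :|: C == S])).
  by rewrite setU1r // (HS B).
have minC D : D \in F -> D \subset S -> C \subset D.
  move=> FD sDS; apply: contraNT noB => /subsetPn[c Cc DNc].
  (* If [D] misses [c], so does the larger set [S :\ c], which is in [F] by the up-set property;
     since [C] gives [c] back, it is a forbidden [B]. *)
  apply/existsP; exists (S :\ c); apply/and3P; split.
  - apply: (one_dense_upset F_union_closed F_one_dense FD).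
    by rewrite subsetD1 sDS.
  - by apply/eqP => eqS; move: (subsetP sCS c Cc); rewrite -eqS setD11.
  - apply/eqP/setP=> x; rewrite !inE.
    by case: eqVneq => [->|_]; rewrite /= ?Cc ?orbT // -orbA orbb.
have GC : C \in minimal_members F.
  rewrite inE; apply/minsetP; split=> // D FD sDC.
  by apply/eqP; rewrite eqEsubset sDC minC // (subset_trans sDC).
have /(mem_uc_closureU KX)/setU1P[eqS|] : C \in rel_upset F (minimal_members F).
- by rewrite inE FC; apply/exists_inP; exists C; rewrite // /rel_subset eqxx.
- by rewrite /S eqS setU11.
rewrite -/S inE => /andP[FS /exists_inP[A]]; rewrite inE => /minsetP[FA minA].
(* [minC] gives [C \subset A], and minimality of [A] turns this into equality. *)
have eqAC : A \subset S -> A = C by move=> sAS; rewrite [C]minA ?minC.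
case/or3P=> [/eqP eqAS|/eqP->|/exists_inP[D FD /andP[neqDS /eqP eqS]]].
- by rewrite setU1r // -eqAS eqAC ?eqAS.
- exact: setU1r.
- by rewrite setU1r // (HS D) // setUC -eqAC // -eqS subsetUl.
Qed.
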